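(* Let $n\ge1$, $d\ge1$, let $c\in\mathsf{SortedRec}(S_{n,d})$ and let $P=\mathsf{f}_{n,d}(c)$ (which lies in $\mathsf{Sawtooth}_{n+1,d}$). Then \[ \mathsf{height}(c)=\mathsf{area}(P)-(n+d)+\binom{n+d}{2}-\binom d2\quad\text{and}\quad\mathsf{topple}_{CTI}(c)=\mathsf{ctiBounce}(P). \]
   Context: The complete split graph $S_{n,d}$ has vertices $s,v_1,\ldots,v_n$ and $w_1,\ldots,w_d$; any two distinct vertices among $s,v_1,\ldots,v_n$ are adjacent, each $w_j$ is adjacent to each of $s,v_1,\ldots,v_n$, no two $w_j$'s are adjacent; $s$ is the sink, $\deg(v_i)=n+d$, $\deg(w_j)=n+1$. A configuration assigns non-negative integers to non-sink vertices, written $(a_1,\ldots,a_n;b_1,\ldots,b_d)$ with $a_i=c(v_i)$, $b_j=c(w_j)$. A non-sink vertex is unstable if its number of grains is $\ge$ its degree; toppling $v$ removes $\deg(v)$ grains from $v$ (if $v\ne s$) and adds one grain to each non-sink neighbour. A stable configuration $c$ is recurrent iff there is an ordering $s=u_0,\ldots,u_{n+d}$ of all vertices such that from $c$, toppling $u_0,\ldots,u_{i-1}$ in turn makes $u_i$ unstable for each $i\ge1$. $\mathsf{SortedRec}(S_{n,d})$: recurrent configurations with $a_1\ge\cdots\ge a_n$ and $b_1\ge\cdots\ge b_d$. $\mathsf{height}(c)=\sum a_i+\sum b_j$. CTI toppling of $c$: topple the sink; then for $i=1,2,\ldots$: topple simultaneously the set $P_i$ of currently unstable clique vertices $v_j$,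 then topple simultaneously the set $Q_i$ of currently unstable independent vertices; stop after the first $i=t$ at which the configuration is stable. $\mathsf{topple}_{CTI}(c)=(|P_1|,|Q_1|,\ldots,|P_t|,|Q_t|)$. Steps: $\mathsf{s}=(0,-1)$, $\mathsf{nw}=(-1,1)$, $\mathsf{n}=(0,1)$, $\mathsf{e}=(1,0)$, $\mathsf{se}=(1,-1)$. $\mathsf{Sawtooth}_{N,d}$ is the set of pairs of lattice paths (upper, lower) from $(0,0)$ to $(N,d)$, the upper with steps in $\{\mathsf{n},\mathsf{se}\}$, the lower with steps in $\{\mathsf{e},\mathsf{n}\}$, meeting only at the endpoints. $\mathsf{f}_{n,d}(c)=(Upp,Low)$ is constructed as follows: (i) for each $i\in[1,d]$ draw a vertical segment from $(1+b_{d+1-i},i-1)$ to $(1+b_{d+1-i},i)$; (ii) join (by horizontal segments) endpoints of these segments having the same $y$-coordinate, join an endpoint with $y$-coordinate $0$ to the origin, and join an endpoint with $y$-coordinate $d$ to $(n+1,d)$; the result is $Low$. (iii) For each $j\in[1,n]$ draw a diagonal segment from $(j-1,3-j+a_{n+1-j})$ to $(j,2-j+a_{n+1-j})$, and draw a diagonal segment from $(n,d+1)$ to $(n+1,d)$; (iv) join (by vertical segments) endpoints of these segments having the same $x$-coordinate, and join an endpoint with $x$-coordinate $0$ to the origin; the result is $Upp$. $\mathsf{area}(P)$ is the number of unit lattice squares contained in the region enclosed by $P$. The CTI-bounce path of $P$ goes from $(n,d)$ to $(0,0)$ with steps in $\{\mathsf{s},\mathsf{nw}\}$: start at $(n,d)$;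 (i) if the current point is on the upper path go to (ii), otherwise move in direction $\mathsf{nw}$ until meeting the upper path; (ii) if the current point is on the lower path go to (iii), otherwise move in direction $\mathsf{s}$ until meeting the lower path; (iii) if the current point is not $(0,0)$ go to (i). The resulting path consists of $p_1$ $\mathsf{nw}$ steps, then $p_1+q_1$ $\mathsf{s}$ steps, then $p_2$ $\mathsf{nw}$ steps, then $p_2+q_2$ $\mathsf{s}$ steps, $\ldots$, then $p_k$ $\mathsf{nw}$ steps and $p_k+q_k$ $\mathsf{s}$ steps; $\mathsf{ctiBounce}(P)=(p_1,q_1,\ldots,p_k,q_k)$. *)

(* Defs.v *)
From HB Require Import structures.
From mathcomp Require Import all_boot all_order all_algebra finmap.
From mathcomp Require Import boolp classical_sets cardinality set_interval reals.

Set Implicit Arguments.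
Unset Strict Implicit.
Unset Printing Implicit Defensive.
Import Order.TTheory GRing.Theory Num.Theory.
Local Open Scope ring_scope.

(** * Sandpile model on the complete split graph *)

(* [None] is the sink s; [Some (inl i)] is v_(i+1), [Some (inr j)] is w_(j+1). *)
Definition vertex (n d : nat) : finType := option ('I_n + 'I_d)%type.

Definition clique_vertex n d (v : vertex n d) : bool :=
  if v is Some (inl _) then true else false.

Definition indep_vertex n d (v : vertex n d) : bool :=
  if v is Some (inr _) then true else false.

Definition adj n d (u v : vertex n d) : bool :=
  (u != v) && ~~ (indep_vertex u && indep_vertex v).

Definition deg n d (v : vertex n d) : nat := #|[set u | adj u v]|.

Definition config (n d : nat) : Type := {ffun ('I_n + 'I_d)%type -> nat}.

Definition height n d (c : config n d) : nat :=
  (\sum_(i < n) c (inl i) + \sum_(j < d) c (inr j))%N.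

Definition unstable n d (c : config n d) (v : vertex n d) : bool :=
  if v is Some x then (deg v <= c x)%N else false.

Definition stable n d (c : config n d) : bool := [forall v, ~~ unstable c v].

(* Simultaneous toppling of all the vertices of [A]. It is only ever applied
   to sets of unstable vertices and to the sink, for which the truncated
   subtraction is exact. *)
Definition topple n d (A : {set vertex n d}) (c : config n d) : config n d :=
  [ffun x => (c x - (if Some x \in A then deg (Some x : vertex n d) else 0)
              + #|[set u in A | adj u (Some x)]|)%N].

Definition topple_seq n d (us : seq (vertex n d)) (c : config n d) : config n d :=
  foldl (fun c' u => topple [set u] c') c us.

(* The ordering u_0, u_1, ... is [None :: us], so that [nth None us i] is
   u_(i+1). *)
Definition recurrent n d (c : config n d) : Prop :=
  stable c /\
  exists us : seq (vertex n d),
    perm_eq (None :: us) (enum (vertex n d)) /\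
    forall i, (i < size us)%N ->
      unstable (topple_seq (None :: take i us) c) (nth None us i).

Definition sorted_rec n d (c : config n d) : Prop :=
  [/\ recurrent c,
      forall i j : 'I_n, (i <= j)%N -> (c (inl j) <= c (inl i))%N &
      forall i j : 'I_d, (i <= j)%N -> (c (inr j) <= c (inr i))%N].

Definition unstable_clique n d (c : config n d) : {set vertex n d} :=
  [set v | unstable c v && clique_vertex v].

Definition unstable_indep n d (c : config n d) : {set vertex n d} :=
  [set v | unstable c v && indep_vertex v].

Definition CTI_P n d (c : config n d) := unstable_clique c.
Definition CTI_Q n d (c : config n d) := unstable_indep (topple (CTI_P c) c).
Definition CTI_round n d (c : config n d) : config n d :=
  topple (CTI_Q c) (topple (CTI_P c) c).

(* [CTI_rounds c w]: the rounds performed from [c] terminate, and [w] lists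
   the sizes |P_1|, |Q_1|, ..., |P_t|, |Q_t|. *)
Inductive CTI_rounds n d : config n d -> seq nat -> Prop :=
| CTI_stop c of stable (CTI_round c) :
    CTI_rounds c [:: #|CTI_P c|; #|CTI_Q c|]
| CTI_next c w of ~~ stable (CTI_round c) & CTI_rounds (CTI_round c) w :
    CTI_rounds c [:: #|CTI_P c|, #|CTI_Q c| & w].

(* Graph of the partial function topple_CTI; see [topple_CTI_fun]. *)
Definition topple_CTI n d (c : config n d) (w : seq nat) : Prop :=
  CTI_rounds (topple [set None] c) w.

Lemma topple_CTI_fun n d (c : config n d) w w' :
  topple_CTI c w -> topple_CTI c w' -> w = w'.
Proof.
rewrite /topple_CTI; move: (topple _ _) => {}c Hw.
elim: Hw w' => {c w} [c st|c w st _ IH] w' Hw'.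
  by case: Hw' st => // c' w0 /negbTE-> _.
case: Hw' st IH => [c' -> //|c' w0 _ Hw0 _ IH].
by rewrite (IH _ Hw0).
Qed.

(** * Sawtooth polyominoes *)

Definition point : Type := (int * int)%type.

Definition step_s : point := (0, -1).
Definition step_nw : point := (-1, 1).
Definition step_n : point := (0, 1).
Definition step_e : point := (1, 0).
Definition step_se : point := (1, -1).

(* A lattice path from the origin is the sequence of its steps; [points w]
   lists the lattice points it visits. *)
Definition points (w : seq point) : seq point := 0 :: scanl +%R 0 w.

(* A pair of paths is (upper, lower). The last condition only says that the
   upper path is indeed the one above. *)
Definition sawtooth (N d : nat) (P : seq point * seq point) : Prop :=
  let fin : point := (N%:Z, d%:Z) in
  [/\ all (mem [:: step_n; step_se]) P.1 /\ last 0 (points P.1) = fin,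
      all (mem [:: step_e; step_n]) P.2 /\ last 0 (points P.2) = fin,
      forall z, z \in points P.1 -> z \in points P.2 -> z = 0 \/ z = fin &
      forall z z' : point, z \in points P.1 -> z' \in points P.2 ->
        z.1 = z'.1 -> z'.2 <= z.2].

Definition hor_link (z z' : point) : seq point := nseq `|z'.1 - z.1|%N step_e.
Definition ver_link (z z' : point) : seq point := nseq `|z'.2 - z.2|%N step_n.

(* Steps of the path from [z] to [fin] running through the unit segments
   [segs], given by their endpoints, in that order; [link] joins the end of a
   segment to the start of the next one. *)
Fixpoint join (link : point -> point -> seq point) (fin z : point)
    (segs : seq (point * point)) : seq point :=
  if segs is (p, q) :: segs' then
    link z p ++ (q - p) :: join link fin q segs'
  else link z fin.

(* [rev_ord] turns the index i-1 of b_i into that of b_(d+1-i). *)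
Definition low_segments n d (c : config n d) : seq (point * point) :=
  [seq (let i := (k.+1)%:Z in let b := (c (inr (rev_ord k)))%:Z in
        ((1 + b, i - 1), (1 + b, i))) | k : 'I_d <- enum 'I_d].

Definition upp_segments n d (c : config n d) : seq (point * point) :=
  [seq (let j := (k.+1)%:Z in let a := (c (inl (rev_ord k)))%:Z in
        ((j - 1, 3 - j + a), (j, 2 - j + a))) | k : 'I_n <- enum 'I_n]
  ++ [:: ((n%:Z, (d.+1)%:Z), ((n.+1)%:Z, d%:Z))].

Definition f_low n d (c : config n d) : seq point :=
  join hor_link ((n.+1)%:Z, d%:Z) 0 (low_segments c).

Definition f_upp n d (c : config n d) : seq point :=
  join ver_link ((n.+1)%:Z, d%:Z) 0 (upp_segments c).

Definition f_nd n d (c : config n d) : seq point * seq point :=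
  (f_upp c, f_low c).

(** ** Area *)

Local Open Scope classical_set_scope.

Definition curve (R : realType) (w : seq point) : set (R * R) :=
  [set z | exists i (t : R),
     let p := nth 0 (points w) i in let q := nth 0 (points w) i.+1 in
     [/\ (i < size w)%N, 0 <= t <= 1,
         z.1 = line_path p.1%:~R q.1%:~R t &
         z.2 = line_path p.2%:~R q.2%:~R t]].

Definition region (R : realType) (P : seq point * seq point) : set (R * R) :=
  [set z | exists l u : R,
     [/\ curve P.2 (z.1, l), curve P.1 (z.1, u) & l <= z.2 <= u]].

Definition unit_square (R : realType) (q : point) : set (R * R) :=
  [set z | q.1%:~R <= z.1 <= (q.1 + 1)%:~R /\ q.2%:~R <= z.2 <= (q.2 + 1)%:~R].

(* [fset_set] is the finite set with the given elements; the squares in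
   question lie in a bounded region. *)
Definition area (R : realType) (P : seq point * seq point) : nat :=
  #|` fset_set [set q : point |
                (unit_square q : set (R * R)) `<=` region P]%classic |%fset.

(** ** Bounce path *)

(* Moving from [z] in direction [s], the path [w] is met after exactly [k]
   steps ([k = 0] when [z] is already on [w]). *)
Definition meets_after (w : seq point) (s z : point) (k : nat) : Prop :=
  z + s *+ k \in points w /\
  forall j, (j < k)%N -> z + s *+ j \notin points w.

Inductive bounce_from (P : seq point * seq point) : point -> seq nat -> Prop :=
| bounce_stop z p q of
    meets_after P.1 step_nw z p &
    meets_after P.2 step_s (z + step_nw *+ p) (p + q) &
    z + step_nw *+ p + step_s *+ (p + q) = 0 :
    bounce_from P z [:: p; q]
| bounce_next z p q w of
    meets_after P.1 step_nw z p &
    meets_after P.2 step_s (z + step_nw *+ p) (p + q) &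
    z + step_nw *+ p + step_s *+ (p + q) <> 0 &
    bounce_from P (z + step_nw *+ p + step_s *+ (p + q)) w :
    bounce_from P z [:: p, q & w].

(* Graph of the partial function ctiBounce on Sawtooth_(n+1,d); see
   [ctiBounce_fun]. *)
Definition ctiBounce (n d : nat) (P : seq point * seq point) (w : seq nat) : Prop :=
  bounce_from P (n%:Z, d%:Z) w.

Lemma meets_after_fun w s z k k' :
  meets_after w s z k -> meets_after w s z k' -> k = k'.
Proof.
move=> [on_k off_k] [on_k' off_k']; case: (ltngtP k k') => // [/off_k'|/off_k].
  by rewrite on_k.
by rewrite on_k'.
Qed.

Lemma ctiBounce_fun n d P w w' :
  ctiBounce n d P w -> ctiBounce n d P w' -> w = w'.
Proof.
rewrite /ctiBounce; move: (_, _) => z Hw.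
elim: Hw w' => {z w} [z p q Up Lo fin|z p q w Up Lo nfin _ IH] w' Hw'.
  inversion_clear Hw' as [z0 p' q' Up' Lo' _|z0 p' q' w0 Up' Lo' nfin' _].
    have E := meets_after_fun Up Up'; subst p'.
    by have /addnI-> := meets_after_fun Lo Lo'.
  have E := meets_after_fun Up Up'; subst p'.
  have /addnI E := meets_after_fun Lo Lo'; subst q'.
  by case: (nfin' fin).
inversion_clear Hw' as [z0 p' q' Up' Lo' fin'|z0 p' q' w0 Up' Lo' _ B'].
  have E := meets_after_fun Up Up'; subst p'.
  have /addnI E := meets_after_fun Lo Lo'; subst q'.
  by case: (nfin fin').
have E := meets_after_fun Up Up'; subst p'.
have /addnI E := meets_after_fun Lo Lo'; subst q'.
by rewrite (IH _ B').
Qed.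

(* Main.v *)
From mathcomp Require Import boolp classical_sets cardinality set_interval.
From mathcomp Require Import all_boot all_order all_algebra finmap reals zify lra.
Require Import Defs.

Set Implicit Arguments.
Unset Strict Implicit.
Unset Printing Implicit Defensive.
Import Order.TTheory GRing.Theory Num.Theory.
Local Open Scope ring_scope.

(* Put X_0 = 0, X_k = 1 + b_(d+1-k), Y_0 = 0, Y_k = 2 + a_(n+1-k), and extend
   X by n+1 and Y by n+d+1. The lower path visits the points (x,y) with
   X_y <= x <= X_(y+1), the upper path those with Y_x <= x+y <= Y_(x+1).
   When x clique and y independent vertices, those with the fewest grains, are
   still to be toppled, the k-th of the former is unstable iff x + y < Y_k and
   the k-th of the latter iff x < X_k. Recurrence thus says that x + y < Y_x or
   x < X_y for all (x,y) <> (0,0), which separates the two paths and keeps the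
   CTI toppling running, and the pair (x,y) of a CTI round is the point at which
   the bounce path leaves the lower path. *)

(** * Steps of joined paths *)

(** Keeping each step together with its starting point turns positional statements about [points]
    and [curve] into membership statements. *)
Fixpoint edges (z : point) (w : seq point) : seq (point * point) :=
  if w is s :: w' then (z, s) :: edges (z + s) w' else [::].

Lemma size_edges z w : size (edges z w) = size w.
Proof. by elim: w z => //= s w IH z; rewrite IH. Qed.

Lemma map_snd_edges z w : [seq e.2 | e <- edges z w] = w.
Proof. by elim: w z => //= s w IH z; rewrite IH. Qed.

Lemma edges_cat z w1 w2 :
  edges z (w1 ++ w2) = edges z w1 ++ edges (foldl +%R z w1) w2.
Proof. by elim: w1 z => //= s w1 IH z; rewrite IH. Qed.

Lemma mem_edges_nseq z s k e :
  reflect (exists2 i, (i < k)%N & e = (z + s *+ i, s)) (e \in edges z (nseq k s)).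
Proof.
apply: (iffP idP) => [|[i lt_ik ->]].
  elim: k z => //= k IH z; rewrite inE => /orP[/eqP->|/IH[i lt_ik ->]].
    by exists 0%N; rewrite // addr0.
  by exists i.+1; rewrite // mulrS addrA.
elim: k i z lt_ik => //= k IH [|i] z lt_ik; rewrite inE ?addr0 ?eqxx //.
by rewrite mulrS addrA IH ?orbT.
Qed.

Lemma foldl_nseq z (s : point) k : foldl +%R z (nseq k s) = z + s *+ k.
Proof. by elim: k z => [|k IH] z /=; rewrite ?addr0 // IH mulrS addrA. Qed.

Lemma nth_edges z w i : (i < size w)%N ->
  let p := nth 0 (z :: scanl +%R z w) i in let q := nth 0 (z :: scanl +%R z w) i.+1 in
  nth (0, 0) (edges z w) i = (p, q - p).
Proof.
elim: w i z => //= s w IH [|i] z lt_iw /=; first by rewrite addrC addKr.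
exact: IH.
Qed.

Lemma last_points z w : last (0 : point) (z :: scanl +%R z w) = foldl +%R z w.
Proof. by elim: w z => //= s w IH z; rewrite -IH. Qed.

Lemma mem_points w p :
  (p \in points w) = (p == foldl +%R 0 w) || (p \in [seq e.1 | e <- edges 0 w]).
Proof.
rewrite /points; elim: w (0 : point) => [|s w IH] z; first by rewrite inE orbF.
by rewrite /= in_cons [in RHS]in_cons orbCA -IH.
Qed.

(* Here [S k] and [E k.+1] are the endpoints of the k-th segment, [E 0] is the
   start of the path and [S m] its end. *)
Lemma foldl_join (link : point -> point -> seq point) (s : point)
    (len : nat -> nat) (S E : nat -> point) m :
  (forall k, (k <= m)%N -> link (E k) (S k) = nseq (len k) s) ->
  (forall k, (k <= m)%N -> E k + s *+ len k = S k) ->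
  foldl +%R (E 0%N) (join link (S m) (E 0%N) [seq (S k, E k.+1) | k <- iota 0 m])
    = S m.
Proof.
move=> linkE lenE; suff gen l k : (k + l = m)%N ->
    foldl +%R (E k) (join link (S m) (E k) [seq (S j, E j.+1) | j <- iota k l]) = S m.
  exact: (gen m 0%N).
elim: l k => [|l IH] k le_km /=.
  have -> : k = m by lia.
  by rewrite linkE ?foldl_nseq ?lenE.
rewrite foldl_cat linkE ?foldl_nseq ?lenE /= 1?[S k + _]addrC ?subrK; [|lia..].
by apply: IH; lia.
Qed.

Lemma mem_edges_join (link : point -> point -> seq point) (s : point)
    (len : nat -> nat) (S E : nat -> point) m e :
  (forall k, (k <= m)%N -> link (E k) (S k) = nseq (len k) s) ->
  (forall k, (k <= m)%N -> E k + s *+ len k = S k) ->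
  (e \in edges (E 0%N)
     (join link (S m) (E 0%N) [seq (S k, E k.+1) | k <- iota 0 m])) <->
  (exists k i, [/\ (k <= m)%N, (i < len k)%N & e = (E k + s *+ i, s)]) \/
  (exists2 k, (k < m)%N & e = (S k, E k.+1 - S k)).
Proof.
move=> linkE lenE; suff gen l k : (k + l = m)%N ->
    (e \in edges (E k) (join link (S m) (E k) [seq (S j, E j.+1) | j <- iota k l])) <->
    (exists j i, [/\ (k <= j <= m)%N, (i < len j)%N & e = (E j + s *+ i, s)]) \/
    (exists2 j, (k <= j < m)%N & e = (S j, E j.+1 - S j)).
  by apply: (iff_trans (gen m 0%N erefl)).
elim: l k => [|l IH] k le_km /=.
  have -> : k = m by lia.
  rewrite linkE //; split=> [/mem_edges_nseq[i lti ->]|[[j [i [lej lti ->]]]|[j]]].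
  - by left; exists m, i; rewrite leqnn.
  - have -> : j = m by lia.
    by apply/mem_edges_nseq; exists i => //; have <- : j = m by lia.
  - by lia.
have /IH {}IH : (k.+1 + l = m)%N by lia.
rewrite linkE ?edges_cat ?foldl_nseq ?lenE /= ?mem_cat ?inE; [|lia..].
have -> : S k + (E k.+1 - S k) = E k.+1 by rewrite addrC subrK.
split=> [/or3P[/mem_edges_nseq[i lti ->]|/eqP->|/IH[]]|].
- by left; exists k, i; split=> //; lia.
- by right; exists k => //; lia.
- by case=> j [i [lej lti ->]]; left; exists j, i; split=> //; lia.
- by case=> j lej ->; right; exists j => //; lia.
case=> [[j [i [lej lti eE]]]|[j lej eE]]; have [Ejk |nejk] := eqVneq j k.
- by subst j; apply/orP; left; apply/mem_edges_nseq; exists i.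
- by apply/or3P/Or33/IH; left; exists j, i; split=> //; lia.
- by rewrite eE Ejk eqxx orbT.
by apply/or3P/Or33/IH; right; exists j => //; lia.
Qed.

(** * Lower and upper paths in terms of X and Y *)

Definition low_path (d : nat) (X : nat -> nat) : seq point :=
  join hor_link ((X d.+1)%:Z, d%:Z) 0
    [seq (((X k.+1)%:Z, k%:Z), ((X k.+1)%:Z, k.+1%:Z)) | k <- iota 0 d].

(** The level, that is the coordinate sum, is constant along a step [se]; subtracting the abscissa
    turns the level [Y k.+1] into an ordinate. *)
Definition upp_path (m : nat) (Y : nat -> nat) : seq point :=
  join ver_link (m%:Z, (Y m.+1)%:Z - m%:Z) 0
    [seq ((k%:Z, (Y k.+1)%:Z - k%:Z), (k.+1%:Z, (Y k.+1)%:Z - k.+1%:Z))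
    | k <- iota 0 m].

Lemma mul_step_e i : step_e *+ i = (i%:Z, 0).
Proof.
by elim: i => [|i IH]; rewrite ?mulr0n // mulrS IH; congr (_, _) => /=; lia.
Qed.

Lemma mul_step_n i : step_n *+ i = (0, i%:Z).
Proof.
by elim: i => [|i IH]; rewrite ?mulr0n // mulrS IH; congr (_, _) => /=; lia.
Qed.

Lemma mul_step_s i : step_s *+ i = (0, - i%:Z).
Proof.
by elim: i => [|i IH]; rewrite ?mulr0n // mulrS IH; congr (_, _) => /=; lia.
Qed.

Lemma mul_step_nw i : step_nw *+ i = (- i%:Z, i%:Z).
Proof.
by elim: i => [|i IH]; rewrite ?mulr0n // mulrS IH; congr (_, _) => /=; lia.
Qed.

Lemma point_eq (a b x y : int) : a = x -> b = y -> (a, b) = (x, y) :> point.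
Proof. by move=> -> ->. Qed.

Section Low.
Variables (d : nat) (X : nat -> nat).
Hypotheses (X0 : X 0%N = 0%N) (leX : forall k, (k <= d)%N -> (X k <= X k.+1)%N).

Let S k : point := ((X k.+1)%:Z, k%:Z).
Let E k : point := ((X k)%:Z, k%:Z).
Let len k := (X k.+1 - X k)%N.

Let linkE k : (k <= d)%N -> hor_link (E k) (S k) = nseq (len k) step_e.
Proof. by move/leX => leXk; rewrite /hor_link /len /=; congr nseq; lia. Qed.

Let lenE k : (k <= d)%N -> E k + step_e *+ len k = S k.
Proof.
by move/leX => leXk; rewrite mul_step_e /len; apply: point_eq => /=; lia.
Qed.

Let pathE : low_path d X = join hor_link (S d) (E 0%N) [seq (S k, E k.+1) | k <- iota 0 d].
Proof. by rewrite /low_path /E X0. Qed.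

Lemma last_low_path : last 0 (points (low_path d X)) = ((X d.+1)%:Z, d%:Z).
Proof.
rewrite last_points pathE.
have -> : (0 : point) = E 0%N by rewrite /E X0.
exact: foldl_join linkE lenE.
Qed.

Lemma mem_low_edges e : e \in edges 0 (low_path d X) <->
  (exists k x, [/\ (k <= d)%N, (X k <= x < X k.+1)%N & e = ((x%:Z, k%:Z), step_e)])
  \/ (exists2 k, (k < d)%N & e = (((X k.+1)%:Z, k%:Z), step_n)).
Proof.
have E0 : (0 : point) = E 0%N by rewrite /E X0.
rewrite E0 pathE; apply: (iff_trans (mem_edges_join _ linkE lenE)).
split=> -[[k [i [lek lti ->]]]|[k ltk ->]].
- left; exists k, (X k + i)%N; rewrite /len in lti; split=> //; first lia.
  by rewrite mul_step_e /E; congr (_, _); apply: point_eq => /=; lia.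
- right; exists k => //; congr (_, _).
  by rewrite /E /S /step_n; apply: point_eq => /=; lia.
- left; exists k, (i - X k)%N; rewrite /len; split=> //; first lia.
  by rewrite mul_step_e /E; congr (_, _); apply: point_eq => /=; lia.
right; exists k => //; congr (_, _).
by rewrite /E /S /step_n; apply: point_eq => /=; lia.
Qed.

Lemma mem_low_points p : p \in points (low_path d X) <->
  (exists k x, [/\ (k <= d)%N, (X k <= x <= X k.+1)%N & p = (x%:Z, k%:Z)]).
Proof.
rewrite mem_points -last_points last_low_path; split.
  case/orP=> [/eqP->|/mapP[e /mem_low_edges[[k [x [lek ltx ->]]]|[k ltk ->]] ->]].
  - by exists d, (X d.+1); split=> //; rewrite leX //=.
  - by exists k, x; split=> //; lia.
  - by exists k, (X k.+1); split=> //; [lia|rewrite leX //=; lia].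
(* In row [k], a point before [X k.+1] starts a horizontal step; the point at [X k.+1] starts a
   vertical one, or ends the path when [k = d]. *)
case=> k [x [lek lex ->]]; have [ltx|gex] := ltnP x (X k.+1).
  apply/orP; right; apply/mapP; exists ((x%:Z, k%:Z), step_e) => //.
  by apply/mem_low_edges; left; exists k, x; split=> //; lia.
have -> : x = X k.+1 by lia.
have [ltk|gek] := ltnP k d.
  apply/orP; right; apply/mapP; exists (((X k.+1)%:Z, k%:Z), step_n) => //.
  by apply/mem_low_edges; right; exists k.
by apply/orP; left; have -> : k = d by lia.
Qed.

Lemma all_low_steps : all (mem [:: step_e; step_n]) (low_path d X).
Proof.
rewrite -[low_path d X](map_snd_edges 0); apply/allP => _ /mapP[e + ->].
by case/mem_low_edges=> [[k [x [_ _ ->]]]|[k _ ->]].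
Qed.
End Low.

Section Upp.
Variables (m : nat) (Y : nat -> nat).
Hypotheses (Y0 : Y 0%N = 0%N) (leY : forall k, (k <= m)%N -> (Y k <= Y k.+1)%N).

Let S k : point := (k%:Z, (Y k.+1)%:Z - k%:Z).
Let E k : point := (k%:Z, (Y k)%:Z - k%:Z).
Let len k := (Y k.+1 - Y k)%N.

Let linkE k : (k <= m)%N -> ver_link (E k) (S k) = nseq (len k) step_n.
Proof. by move/leY => leYk; rewrite /ver_link /len /=; congr nseq; lia. Qed.

Let lenE k : (k <= m)%N -> E k + step_n *+ len k = S k.
Proof.
by move/leY => leYk; rewrite mul_step_n /len; apply: point_eq => /=; lia.
Qed.

Let pathE : upp_path m Y = join ver_link (S m) (E 0%N) [seq (S k, E k.+1) | k <- iota 0 m].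
Proof. by rewrite /upp_path /E Y0. Qed.

Lemma last_upp_path :
  last 0 (points (upp_path m Y)) = (m%:Z, (Y m.+1)%:Z - m%:Z).
Proof.
rewrite last_points pathE.
have -> : (0 : point) = E 0%N by rewrite /E Y0.
exact: foldl_join linkE lenE.
Qed.

Lemma mem_upp_edges e : e \in edges 0 (upp_path m Y) <->
  (exists k t, [/\ (k <= m)%N, (Y k <= t < Y k.+1)%N
                 & e = ((k%:Z, t%:Z - k%:Z), step_n)])
  \/ (exists2 k, (k < m)%N & e = ((k%:Z, (Y k.+1)%:Z - k%:Z), step_se)).
Proof.
have E0 : (0 : point) = E 0%N by rewrite /E Y0.
rewrite E0 pathE; apply: (iff_trans (mem_edges_join _ linkE lenE)).
split=> -[[k [i [lek lti ->]]]|[k ltk ->]].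
- left; exists k, (Y k + i)%N; rewrite /len in lti; split=> //; first lia.
  by rewrite mul_step_n /E; congr (_, _); apply: point_eq => /=; lia.
- right; exists k => //; congr (_, _).
  by rewrite /E /S /step_se; apply: point_eq => /=; lia.
- left; exists k, (i - Y k)%N; rewrite /len; split=> //; first lia.
  by rewrite mul_step_n /E; congr (_, _); apply: point_eq => /=; lia.
right; exists k => //; congr (_, _).
by rewrite /E /S /step_se; apply: point_eq => /=; lia.
Qed.

Lemma mem_upp_points p : p \in points (upp_path m Y) <->
  (exists k t, [/\ (k <= m)%N, (Y k <= t <= Y k.+1)%N & p = (k%:Z, t%:Z - k%:Z)]).
Proof.
rewrite mem_points -last_points last_upp_path; split.
  case/orP=> [/eqP->|/mapP[e /mem_upp_edges[[k [t [lek ltt ->]]]|[k ltk ->]] ->]].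
  - by exists m, (Y m.+1); split=> //; rewrite leY //=.
  - by exists k, t; split=> //; lia.
  - by exists k, (Y k.+1); split=> //; [lia|rewrite leY //=; lia].
case=> k [t [lek let_ ->]]; have [ltt|get] := ltnP t (Y k.+1).
  apply/orP; right; apply/mapP; exists ((k%:Z, t%:Z - k%:Z), step_n) => //.
  by apply/mem_upp_edges; left; exists k, t; split=> //; lia.
have -> : t = Y k.+1 by lia.
have [ltk|gek] := ltnP k m.
  apply/orP; right; apply/mapP; exists ((k%:Z, (Y k.+1)%:Z - k%:Z), step_se) => //.
  by apply/mem_upp_edges; right; exists k.
by apply/orP; left; have -> : k = m by lia.
Qed.

Lemma all_upp_steps : all (mem [:: step_n; step_se]) (upp_path m Y).
Proof.
rewrite -[upp_path m Y](map_snd_edges 0); apply/allP => _ /mapP[e + ->].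
by case/mem_upp_edges=> [[k [t [_ _ ->]]]|[k _ ->]].
Qed.
End Upp.

(** * Sawtooth polyominoes *)

(* [sd_gap] is the recurrence condition, see [sorted_rec_gap]. *)
Record sawtooth_data (n d : nat) (X Y : nat -> nat) : Prop := SawtoothData {
  sd_X0 : X 0%N = 0%N;
  sd_Xd : forall k, (d < k)%N -> X k = n.+1;
  sd_X : {homo X : i j / (i <= j)%N};
  sd_Y0 : Y 0%N = 0%N;
  sd_Yn : forall k, (n < k)%N -> Y k = (n + d).+1;
  sd_Y : {homo Y : i j / (i <= j)%N};
  sd_gap : forall x y, (x <= n)%N -> (y <= d)%N -> (0 < x + y)%N ->
    (0 < x)%N && (x + y < Y x)%N || (0 < y)%N && (x < X y)%N }.

Section Sawtooth.
Variables (n d : nat) (X Y : nat -> nat).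
Hypothesis sd : sawtooth_data n d X Y.

Let low := low_path d X.
Let upp := upp_path n.+1 Y.

Lemma sd_lowP p : p \in points low <->
  (exists k x, [/\ (k <= d)%N, (X k <= x <= X k.+1)%N & p = (x%:Z, k%:Z)]).
Proof. by apply: mem_low_points (sd_X0 sd) _ _ => k _; apply/(sd_X sd)/leqnSn. Qed.

Lemma sd_uppP p : p \in points upp <->
  (exists k t, [/\ (k <= n.+1)%N, (Y k <= t <= Y k.+1)%N & p = (k%:Z, t%:Z - k%:Z)]).
Proof. by apply: mem_upp_points (sd_Y0 sd) _ _ => k _; apply/(sd_Y sd)/leqnSn. Qed.

(** A lower point [(x, l)] has [X l <= x], which excludes the second alternative of [sd_gap], so
    [x + l < Y x]; upper points of abscissa [x] have level at least [Y x]. *)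
Lemma sd_low_upp x y y' : (0 < x <= n)%N ->
  (x%:Z, y) \in points upp -> (x%:Z, y') \in points low -> y' < y.
Proof.
move=> x_bd /sd_uppP[k [t [lek let_ [xk ->]]]] /sd_lowP[l [x' [lel lex [xx' ->]]]].
have := @sd_gap _ _ _ _ sd x l.
have -> : k = x by lia.
have -> : x = x' by lia.
have -> : x' = k by lia.
lia.
Qed.

Lemma sd_sawtooth : sawtooth n.+1 d (upp, low).
Proof.
have leX k : (k <= d)%N -> (X k <= X k.+1)%N by move=> _; apply/(sd_X sd)/leqnSn.
have leY k : (k <= n.+1)%N -> (Y k <= Y k.+1)%N by move=> _; apply/(sd_Y sd)/leqnSn.
have YN := sd_Yn sd; have XN := sd_Xd sd; have Y0 := sd_Y0 sd; have X0 := sd_X0 sd.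
(* Hence the lower path meets the line of abscissa 0 only at the origin. For [d = 0] the value is
   the padding [n.+1]. *)
have X1 : (0 < X 1%N)%N.
  have := @sd_gap _ _ _ _ sd 0 1.
  by have [gtd|led] := ltnP d 1; [rewrite XN|lia].
split=> /=.
- split; first exact: all_upp_steps.
  by rewrite [LHS](last_upp_path Y0 leY) YN //; apply: point_eq; lia.
- split; first exact: all_low_steps.
  by rewrite [LHS](last_low_path X0 leX) XN.
- move=> [x y] zU zL; have [x' [y' [bd [[xE yE] [k [lek bdk yk]]]]]] : exists x' y' : nat,
      (x' <= n.+1)%N /\ ((x, y) = (x'%:Z, y'%:Z) :> point) /\
      exists k, [/\ (k <= d)%N, (X k <= x' <= X k.+1)%N & y' = k].
    case/sd_lowP: (zL) => k [x' [lek lex ->]].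
    exists x', k; split.
      by have := sd_X sd (lek : (k.+1 <= d.+1)%N); rewrite (XN d.+1) //; lia.
    by split=> //; exists k.
  subst x y y'; have [x0|xgt] := posnP x'; last first.
    have [lexn|gtx] := leqP x' n.
      by have := @sd_low_upp x' _ _ _ zU zL; lia.
    (* At abscissa [n.+1] the only level of the upper path is [(n + d).+1], which forces the
       ordinate [d]. *)
    right; apply: point_eq; first by lia.
    case/sd_uppP: zU => j [t [lej let_ [xj tj]]].
    have ? : j = n.+1 by lia.
    by subst j; rewrite !YN // in let_; lia.
  left; subst x'; have [->//|kgt] := posnP k.
  have := sd_X sd (kgt : (1 <= k)%N); lia.
move=> [x y] [x' y'] /= zU zL xx'; subst x'.
case/sd_uppP: (zU) => j [t [lej let_ [xj tj]]].
case/sd_lowP: (zL) => k [x' [lek lex [xx' yk]]]; subst x y y'.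
have ? : x' = j by lia.
subst x'; have [j0|jgt] := posnP j.
  have [->|kgt] := posnP k; first lia.
  have := sd_X sd (kgt : (1 <= k)%N); lia.
have [lejn|gtj] := leqP j n.
  by have := sd_low_upp _ zU zL; rewrite jgt => /(_ lejn); lia.
have ? : j = n.+1 by lia.
by subst j; rewrite !YN // in let_; lia.
Qed.

(** A step [nw] preserves the level [x + y], so the ray stays strictly below the upper path at
    abscissa [j] as long as [x + y < Y j]. *)
Lemma sd_meets_nw x y x' : (x' <= x <= n)%N -> (x + y < Y x.+1)%N ->
  (Y x' <= x + y)%N -> (forall j, (x' < j <= x)%N -> (x + y < Y j)%N) ->
  meets_after upp step_nw (x%:Z, y%:Z) (x - x').
Proof.
move=> bd_x Yx Yx' maxx'; split.
  apply/sd_uppP; exists x', (x + y)%N; split; first lia.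
    rewrite Yx' ltnW //; have [->//|ne] := eqVneq x' x.
    by apply: maxx'; lia.
  by rewrite mul_step_nw; apply: point_eq => /=; lia.
move=> j ltj; apply/negP => /sd_uppP[k [t [lek let_]]].
rewrite mul_step_nw => -[/= xk tk].
have xjk : k = (x - j)%N by lia.
by subst k; have := maxx' (x - j)%N; lia.
Qed.

(** At ordinates [k > y], crossed by the first [p] steps, [X k >= X y.+1 > x >= x'] keeps the lower
    path to the right. From ordinate [y] down, the path is met at the first [k] with [X k <= x']. *)
Lemma sd_meets_s x x' y y' p : (x' <= x <= n)%N -> (y' <= y <= d)%N -> (x < X y.+1)%N ->
  (X y' <= x')%N -> (forall j, (y' < j <= y)%N -> (x' < X j)%N) ->
  meets_after low step_s (x'%:Z, (y + p)%:Z) (p + (y - y')).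
Proof.
move=> bd_x bd_y Xy Xy' maxy'; split.
  apply/sd_lowP; exists y', x'; split; first lia.
    rewrite Xy'; have [E|ne] := eqVneq y' y; first by rewrite E; lia.
    by apply/ltnW/maxy'; lia.
  by rewrite mul_step_s; apply: point_eq => /=; lia.
move=> j ltj; apply/negP => /sd_lowP[k [t [lek let_]]].
rewrite mul_step_s => -[/= xt yk].
have [leky|gtk] := leqP k y.
  by have := maxy' k; lia.
by have := sd_X sd (gtk : (y.+1 <= k)%N); lia.
Qed.
End Sawtooth.

(** * Area *)

Lemma curveP (R : realType) w (z : R * R) : curve w z <->
  exists (e : point * point) (t : R), [/\ e \in edges 0 w, 0 <= t <= 1,
     z.1 = e.1.1%:~R + t * e.2.1%:~R & z.2 = e.1.2%:~R + t * e.2.2%:~R].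
Proof.
have pathE (a b : int) (t : R) :
    line_path a%:~R b%:~R t = a%:~R + t * (b - a)%:~R.
  by rewrite line_pathEl intrB addrC.
split=> [[i [t /=]]|[e [t []]]].
  rewrite !pathE => -[lti t01 zx zy]; exists (nth (0, 0) (edges 0 w) i), t.
  split=> //; first by rewrite mem_nth ?size_edges.
    by rewrite nth_edges.
  by rewrite nth_edges.
case/(nthP (0, 0)) => i; rewrite size_edges => lti; rewrite nth_edges // => <- t01 zx zy.
by exists i, t; split=> //; rewrite pathE.
Qed.

(** In column [x] the lower path is a horizontal edge, at ordinate at most [y] iff [x < X y.+1]. The
    upper path is a diagonal edge of level [Y x.+1], which must not pass below the corner
    [(x + 1, y + 1)]. *)
Lemma sd_unit_square (R : realType) n d X Y (q : point) : sawtooth_data n d X Y ->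
  (unit_square q `<=` @region R (upp_path n.+1 Y, low_path d X))%classic <->
  exists x y : nat, [/\ (x <= n)%N, (x < X y.+1)%N, (x + y + 2 <= Y x.+1)%N
                      & q = (x%:Z, y%:Z)].
Proof.
move=> sd.
have leX k : (k <= d)%N -> (X k <= X k.+1)%N by move=> _; apply/(sd_X sd)/leqnSn.
have leY k : (k <= n.+1)%N -> (Y k <= Y k.+1)%N by move=> _; apply/(sd_Y sd)/leqnSn.
have lowP := mem_low_edges (sd_X0 sd) leX.
have uppP := mem_upp_edges (sd_Y0 sd) leY.
split=> [sub|[x [y [lexn ltxX leY2 ->]]]]; last first.
  move=> [z1 z2] /= [z1bd z2bd].
  (* [k] is the ordinate of the horizontal edge of the lower path in column [x]. *)
  have [k ltxk min_k] : {k | (x < X k.+1)%N & forall j, (x < X j.+1)%N -> (k <= j)%N}.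
    by case: (ex_minnP (ex_intro (fun k => x < X k.+1)%N y ltxX)) => k; exists k.
  have leky := min_k y ltxX.
  have lekd : (k <= d)%N by apply: min_k; rewrite (sd_Xd sd).
  have leXk : (X k <= x)%N.
    case: k {ltxk leky lekd} min_k => [|k] min_k; first by rewrite (sd_X0 sd).
    by rewrite leqNgt; apply/negP => /min_k; rewrite ltnn.
  exists k%:R, ((Y x.+1)%:R - x%:R - (z1 - x%:R)); split.
  - apply/curveP; exists ((x%:Z, k%:Z), step_e), (z1 - x%:R); split=> /=; last 2 first.
    + by rewrite mulr1 -pmulrn; lra.
    + by rewrite mulr0 addr0 -pmulrn.
    + by apply/lowP; left; exists k, x; rewrite lekd leXk.
    + by move: z1bd; rewrite /= intrD -!pmulrn; lra.
  - apply/curveP; exists ((x%:Z, (Y x.+1)%:Z - x%:Z), step_se), (z1 - x%:R).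
    split=> /=; last 2 first.
    + by rewrite mulr1 -pmulrn; lra.
    + by rewrite intrB -!pmulrn mulrN1.
    + by apply/uppP; right; exists x.
    + by move: z1bd; rewrite /= intrD -!pmulrn; lra.
  move: z1bd z2bd; rewrite /= !intrD -!pmulrn.
  have : (k%:R <= y%:R :> R) by rewrite ler_nat.
  have : ((x + y + 2)%:R <= (Y x.+1)%:R :> R) by rewrite ler_nat.
  by rewrite !natrD; lra.
case: q sub => q1 q2 sub.
(* The abscissa of the midpoint determines the edges above and below it, whereas
   an integral one may lie on vertical edges. *)
have mid y : q2%:~R <= y <= (q2 + 1)%:~R -> region (upp_path n.+1 Y, low_path d X)
    (q1%:~R + 2^-1, y : R).
  by move=> y_bd; apply: sub; split=> //=; rewrite intrD; lra.
have int_half (x : int) (t : R) :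
    0 <= t <= 1 -> q1%:~R + 2^-1 = x%:~R + t -> x = q1 /\ t = 2^-1.
  move=> t01 E; suff xq : x = q1 by subst x; split=> //; lra.
  have : x < q1 + 1 by rewrite -(ltr_int R) intrD; lra.
  have : q1 < x + 1 by rewrite -(ltr_int R) intrD; lra.
  by lia.
have int_not_half (x : int) (t : R) : q1%:~R + 2^-1 = x%:~R + t * 0 -> False.
  move=> E.
  have : x < q1 + 1 by rewrite -(ltr_int R) intrD; lra.
  have : q1 < x by rewrite -(ltr_int R); lra.
  by lia.
have [|l [_ [/curveP[e [t [+ t01 /= z1E lE]]] _ /andP[/= le_lq _]]]] := mid q2%:~R.
  by rewrite lexx intrD; lra.
case/lowP=> [[k [x [lekd bdx eE]]]|[k _ eE]]; subst e; last by case: (int_not_half _ _ z1E).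
rewrite /= mulr1 in z1E; case: (int_half _ _ t01 z1E) => xq1 _.
have lekq : k%:Z <= q2 by rewrite -(ler_int R); rewrite lE /= mulr0 in le_lq; lra.
have [|_ [u [_ /curveP[e' [t' [+ t'01 /= z1E' uE]]] /andP[/= _ le_qu]]]] := mid (q2 + 1)%:~R.
  by rewrite lexx intrD; lra.
case/uppP=> [[k' [x' [_ _ eE]]]|[k' ltk' eE]]; subst e'; first by case: (int_not_half _ _ z1E').
rewrite /= mulr1 in z1E'; case: (int_half _ _ t'01 z1E') => xq1' t'E.
(* At its midpoint the diagonal edge is half a unit below its start; the resulting strict inequality
   between integers provides the second unit in [x + y + 2]. *)
have ltq2 : q2 + 1 < (Y k'.+1)%:Z - k'%:Z.
  by rewrite -(ltr_int R); rewrite uE /= t'E in le_qu; lra.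
exists x, `|q2|%N.
have kx : k' = x by lia.
subst k' q1; split; [lia| |lia|by apply: point_eq; lia].
apply: (@leq_trans (X k.+1)); first lia.
by apply: (sd_X sd); lia.
Qed.

Lemma sum_leq_const a m : (\sum_(0 <= x < m) (a <= x : nat) = m - a)%N.
Proof.
elim: m => [|m IH]; first by rewrite big_geq.
by rewrite big_nat_recr //= IH; case: leqP; lia.
Qed.

Lemma count_iota_bounded (P : pred nat) k l :
  (forall y, P y -> (y < k)%N && (y < l)%N) ->
  count P (iota 0 k) = count P (iota 0 l).
Proof.
move=> bd; rewrite -!size_filter; apply/perm_size/uniq_perm.
- by rewrite filter_uniq ?iota_uniq.
- by rewrite filter_uniq ?iota_uniq.
move=> y; rewrite !mem_filter !mem_iota /= !add0n.
by case Py: (P y) => //=; have /andP[-> ->] := bd y Py.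
Qed.

(** The full cells under the diagonal edge of column [x] are either squares of the polyomino or
    cells below the lower path. *)
Lemma sd_column n d X Y x : sawtooth_data n d X Y -> (x <= n)%N ->
  (count (fun y => x < X y.+1) (iota 0 (Y x.+1 - x.+1)) +
   \sum_(0 <= y < d) (X y.+1 <= x : nat) = Y x.+1 - x.+1)%N.
Proof.
move=> sd lexn; pose big y := (x < X y.+1)%N.
have -> : (\sum_(0 <= y < d) (X y.+1 <= x : nat) = count (predC big) (iota 0 d))%N.
  rewrite -sum1_count [RHS]big_mkcond /index_iota subn0.
  by apply: eq_bigr => y _; rewrite /big /= -leqNgt; case: leqP.
(* A cell below the lower path has [y < d] because of the padding of [X], and lies under the
   diagonal by [sd_gap] at [(x.+1, y.+1)], or by the padding of [Y] when [x = n]. *)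
rewrite -(@count_iota_bounded _ (Y x.+1 - x.+1)); last first.
  move=> y; rewrite /big /= -leqNgt => leXx.
  have ltyd : (y < d)%N.
    by rewrite ltnNge; apply/negP => ledy; rewrite (sd_Xd sd) in leXx; lia.
  rewrite ltyd andbT; have [ltxn|gexn] := ltnP x n.
    by have := @sd_gap _ _ _ _ sd x.+1 y.+1; lia.
  by rewrite (sd_Yn sd); lia.
by rewrite count_predC size_iota.
Qed.

Lemma sd_area (R : realType) n d X Y : sawtooth_data n d X Y ->
  (area R (upp_path n.+1 Y, low_path d X) + \sum_(0 <= y < d) (n.+1 - X y.+1) =
   \sum_(0 <= x < n.+1) (Y x.+1 - x.+1))%N.
Proof.
move=> sd.
pose col x := [seq y <- iota 0 (Y x.+1 - x.+1) | (x < X y.+1)%N].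
pose s := [seq ((x%:Z, y%:Z) : Defs.point) | x <- iota 0 n.+1, y <- col x].
have -> : area R (upp_path n.+1 Y, low_path d X) = size s.
  rewrite /area -(undup_id (_ : uniq s)); last first.
    apply: allpairs_uniq_dep; rewrite ?iota_uniq //.
      by move=> x _; rewrite filter_uniq ?iota_uniq.
    by move=> [x y] [x' y'] _ _ /= [-> ->].
  rewrite -card_fseq; congr #|` _|%fset.
  rewrite -[RHS]set_fsetK; congr fset_set; apply/seteqP; split=> q /=.
    case/(sd_unit_square _ _ sd) => x [y [lexn ltxX leY ->]].
    rewrite in_fset /s; apply/allpairsPdep; exists x, y.
    by rewrite mem_filter !mem_iota ltxX; split=> //; lia.
  rewrite in_fset /s => /allpairsPdep[x [y []]].
  rewrite mem_filter !mem_iota => lexn /andP[ltxX leY] ->.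
  by apply/(sd_unit_square _ _ sd); exists x, y; split=> //; lia.
rewrite size_allpairs_dep sumnE big_map.
(* The cells below the lower path, counted by rows and then by columns. *)
have -> : (\sum_(0 <= y < d) (n.+1 - X y.+1) =
    \sum_(0 <= x < n.+1) \sum_(0 <= y < d) (X y.+1 <= x : nat))%N.
  by rewrite exchange_big /=; apply: eq_bigr => y _; rewrite sum_leq_const.
rewrite -[iota 0 n.+1]/(index_iota 0 n.+1) -big_split /=.
apply: eq_big_nat => x /andP[_ lexn].
by rewrite size_filter (sd_column sd).
Qed.

(** * Toppling *)

Definition toppled_nbrs n d (S : {set vertex n d}) (x : 'I_n + 'I_d) : nat :=
  #|[set u in S | adj u (Some x)]|.

(* Result of toppling each vertex of [S] once, starting from [c]. *)
Definition toppled_config n d (c : config n d) (S : {set vertex n d}) : config n d :=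
  [ffun x => (c x + toppled_nbrs S x - (if Some x \in S then deg (Some x : vertex n d) else 0))%N].

(* Each vertex of [S] held enough grains to topple, so that the truncated
   subtraction in [toppled_config c S] is exact. *)
Definition legal n d (c : config n d) (S : {set vertex n d}) : Prop :=
  forall x, Some x \in S -> (deg (Some x : vertex n d) <= c x + toppled_nbrs S x)%N.

(* Complement of the [x] clique and [y] independent vertices with the fewest
   grains, the configuration being sorted. *)
Definition done_set n d (x y : nat) : {set vertex n d} :=
  [set v : vertex n d | match v with
           | None => true
           | Some (inl i) => (x < n - i)%N
           | Some (inr j) => (y < d - j)%N
           end].

Lemma card_done_set n d x y : (x <= n)%N -> (y <= d)%N ->
  #|done_set n d x y| = (1 + (n - x) + (d - y))%N.
Proof.
move=> lexn leyd.
have sum_ord m k : (\sum_(i < m) (k < m - i : nat) = m - k)%N.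
  rewrite -sum_leq_const big_mkord (reindex_inj rev_ord_inj) /=.
  by apply: eq_bigr => i _; congr (nat_of_bool _); have := ltn_ord i; lia.
pose D := [set v : 'I_n + 'I_d | Some v \in done_set n d x y].
have -> : done_set n d x y = None |: Some @: D.
  apply/setP => -[v|]; rewrite in_setU1 ?inE //=.
  by rewrite mem_imset /D ?inE // => ? ? [].
rewrite cardsU1 card_imset; last by move=> v w [].
have -> : None \notin Some @: D by apply/imsetP => -[].
rewrite -addnA; congr addn.
rewrite -sum1_card big_mkcond big_sumType /=; congr addn.
  by rewrite -[RHS]sum_ord; apply: eq_bigr => i _; rewrite !inE; case: (x < n - i)%N.
by rewrite -[RHS]sum_ord; apply: eq_bigr => i _; rewrite !inE; case: (y < d - i)%N.
Qed.

Lemma deg_clique n d (i : 'I_n) : deg (Some (inl i) : vertex n d) = (n + d)%N.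
Proof.
(* [done_set n d 0 0] is the whole vertex set. *)
rewrite /deg; have -> : [set u | adj u (Some (inl i) : vertex n d)] =
    done_set n d 0 0 :\ Some (inl i).
  apply/setP => -[[k|k]|]; rewrite !inE /adj //= ?andbT ?subn_gt0 ?ltn_ord ?andbT //.
have iD : Some (inl i) \in done_set n d 0 0 by rewrite inE subn_gt0.
apply/(@addnI (Some (inl i) \in done_set n d 0 0)).
by rewrite -cardsD1 card_done_set // iD; lia.
Qed.

Lemma toppled_nbrs_clique n d (S : {set vertex n d}) (i : 'I_n) :
  Some (inl i) \notin S -> toppled_nbrs S (inl i) = #|S|.
Proof.
move=> iS; apply: eq_card => u; rewrite !inE /adj andbF andbT.
by case: eqVneq => [->|]; rewrite ?andbT // (negbTE iS).
Qed.

(** The right-hand side consists of the possible neighbours of an independent vertex, so that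
    [card_done_set] also counts these. *)
Lemma done_set_indep n d (x y : nat) :
  done_set n d x d = [set u in done_set n d x y | ~~ indep_vertex u].
Proof.
by apply/setP => -[[i|j]|]; rewrite !inE ?andbT ?andbF //; apply/negbTE; lia.
Qed.

Lemma deg_indep n d (j : 'I_d) : deg (Some (inr j) : vertex n d) = n.+1.
Proof.
rewrite /deg; have -> : [set u | adj u (Some (inr j) : vertex n d)] = done_set n d 0 d.
  rewrite (done_set_indep _ _ _ 0); apply/setP => -[[i|k]|];
    by rewrite !inE /adj //= ?subn_gt0 ?ltn_ord ?andbF.
by rewrite card_done_set //; lia.
Qed.

Lemma toppled_nbrs_indep n d x y (j : 'I_d) : (x <= n)%N ->
  toppled_nbrs (done_set n d x y) (inr j) = (1 + (n - x))%N.
Proof.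
move=> lexn; rewrite /toppled_nbrs -[RHS]addn0 -{2}(subnn d) -card_done_set //.
rewrite (done_set_indep _ _ _ y); apply: eq_card => -[[i|k]|];
  by rewrite !inE /adj //= ?andbT ?andbF.
Qed.

Lemma toppled_nbrs_sub n d (S T : {set vertex n d}) x :
  S \subset T -> (toppled_nbrs S x <= toppled_nbrs T x)%N.
Proof.
by move=> ST; apply/subset_leq_card/subsetP => u; rewrite !inE => /andP[/(subsetP ST)-> ->].
Qed.

Lemma toppled_nbrs_le_deg n d (S : {set vertex n d}) x :
  (toppled_nbrs S x <= deg (Some x : vertex n d))%N.
Proof.
by apply/subset_leq_card/subsetP => u; rewrite !inE => /andP[].
Qed.

Lemma toppled_nbrsU n d (S T : {set vertex n d}) x : [disjoint S & T] ->
  toppled_nbrs (S :|: T) x = (toppled_nbrs S x + toppled_nbrs T x)%N.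
Proof.
move=> dST; rewrite /toppled_nbrs setIdE setIUl -!setIdE cardsU disjoint_setI0 ?cards0 ?subn0 //.
by rewrite -setI_eq0; apply/eqP/setP => u; rewrite !inE;
  case uS: (u \in S); rewrite //= (disjointFr dST uS) andbF.
Qed.

Lemma toppled_config0 n d (c : config n d) : toppled_config c set0 = c.
Proof.
apply/ffunP => x; rewrite ffunE inE subn0 /toppled_nbrs
  (_ : [set u in _ | _] = set0) ?cards0 ?addn0 //.
by apply/setP => u; rewrite !inE.
Qed.

Lemma legal0 n d (c : config n d) : legal c set0.
Proof. by move=> x; rewrite inE. Qed.

(** The configuration reached depends only on the set of vertices toppled so far. Legality makes the
    subtractions exact, hence interchangeable with the additions. *)
Lemma topple_config n d (c : config n d) (S T : {set vertex n d}) :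
  legal c S -> [disjoint S & T] ->
  (forall x, Some x \in T -> unstable (toppled_config c S) (Some x)) ->
  topple T (toppled_config c S) = toppled_config c (S :|: T) /\ legal c (S :|: T).
Proof.
move=> legS dST unsT; have unsT' x : Some x \in T ->
    (deg (Some x : vertex n d) <= c x + toppled_nbrs S x)%N /\ Some x \notin S.
  move=> xT; have xS : Some x \notin S by rewrite (disjointFl dST xT).
  by have := unsT x xT; rewrite /= ffunE (negbTE xS) subn0.
split=> [|x]; last first.
  rewrite inE toppled_nbrsU // => /orP[/legS|/unsT'[]]; lia.
apply/ffunP => x; rewrite !ffunE toppled_nbrsU // inE -/(toppled_nbrs T x).
have [xS|xS] /= := boolP (Some x \in S).
  by rewrite (disjointFr dST xS) subn0 addnA addnBAC // legS.
have [xT|xT] := boolP (Some x \in T); last by rewrite !subn0 addnA.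
by have [le_deg _] := unsT' x xT; rewrite subn0 addnA addnBAC.
Qed.

(** A toppled vertex has lost its degree and regained at most as much, so it holds no more than in
    the stable [c]: no vertex topples twice. *)
Lemma unstable_toppled n d (c : config n d) (S : {set vertex n d}) x :
  stable c -> Some x \in S -> ~~ unstable (toppled_config c S) (Some x).
Proof.
move=> /forallP /(_ (Some x)) /= stx xS; rewrite ffunE xS -ltnNge.
rewrite -ltnNge in stx; apply: leq_ltn_trans stx.
by rewrite leq_subLR addnC leq_add2r toppled_nbrs_le_deg.
Qed.

(** * The sequences X and Y of a configuration *)

Definition abscissa n d (c : config n d) (k : nat) : nat :=
  if k is k'.+1 then
    if insub k' is Some j then (c (inr (rev_ord (j : 'I_d)))).+1 else n.+1
  else 0.

(** The shift by two is the one in the level of a diagonal segment, [(j - 1) + (3 - j + a) = a + 2];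
    a failing [insub] yields the padding. *)
Definition levels n d (c : config n d) (k : nat) : nat :=
  if k is k'.+1 then
    if insub k' is Some i then (c (inl (rev_ord (i : 'I_n)))).+2 else (n + d).+1
  else 0.

Lemma abscissaE n d (c : config n d) (j : 'I_d) : abscissa c (d - j) = (c (inr j)).+1.
Proof.
have := ltn_ord j; rewrite /abscissa -{3}[j]rev_ordK.
have -> : (d - j)%N = (rev_ord j).+1 by rewrite /=; have := ltn_ord j; lia.
by rewrite valK.
Qed.

Lemma levelsE n d (c : config n d) (i : 'I_n) : levels c (n - i) = (c (inl i)).+2.
Proof.
have := ltn_ord i; rewrite /levels -{3}[i]rev_ordK.
have -> : (n - i)%N = (rev_ord i).+1 by rewrite /=; have := ltn_ord i; lia.
by rewrite valK.
Qed.

(** An untoppled clique vertex has received a grain from each of the [1 + (n - x) + (d - y)] toppled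
    vertices, so it reaches its degree [n + d] iff [x + y] is less than its initial content plus
    two. *)
Lemma unstable_clique_done n d (c : config n d) x y (i : 'I_n) : stable c ->
  (x <= n)%N -> (y <= d)%N -> unstable (toppled_config c (done_set n d x y)) (Some (inl i)) =
  (n - i <= x)%N && (x + y < levels c (n - i))%N.
Proof.
move=> st lexn leyd; have [lei|gti] := leqP (n - i) x.
  have iS : Some (inl i) \notin done_set n d x y by rewrite inE -leqNgt.
  by rewrite /= ffunE (negbTE iS) toppled_nbrs_clique // card_done_set // deg_clique levelsE;
    move: (c _) => k; lia.
by apply/negbTE/unstable_toppled; rewrite // inE.
Qed.

Lemma unstable_indep_done n d (c : config n d) x y (j : 'I_d) : stable c ->
  (x <= n)%N -> unstable (toppled_config c (done_set n d x y)) (Some (inr j)) =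
  (d - j <= y)%N && (x < abscissa c (d - j))%N.
Proof.
move=> st lexn; have [lej|gtj] := leqP (d - j) y.
  have jS : Some (inr j) \notin done_set n d x y by rewrite inE -leqNgt.
  by rewrite /= ffunE (negbTE jS) toppled_nbrs_indep // deg_indep abscissaE; move: (c _) => k; lia.
by apply/negbTE/unstable_toppled; rewrite // inE.
Qed.

Lemma stable_clique_bound n d (c : config n d) i : stable c -> (c (inl i) < n + d)%N.
Proof. by move=> /forallP /(_ (Some (inl i))) /=; rewrite deg_clique -ltnNge. Qed.

Lemma stable_indep_bound n d (c : config n d) j : stable c -> (c (inr j) <= n)%N.
Proof. by move=> /forallP /(_ (Some (inr j))) /=; rewrite deg_indep -ltnNge. Qed.

Lemma topple_sink n d (c : config n d) :
  topple [set None] c = toppled_config c [set None] /\ legal c [set None].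
Proof.
(* The sink carries no grains, so the instability condition of [topple_config] is vacuous here. *)
have := @topple_config _ _ c set0 [set None] (@legal0 _ _ c).
rewrite toppled_config0 set0U; apply; first by rewrite -setI_eq0 set0I.
by move=> x; rewrite inE.
Qed.

(** Uniqueness of the ordering makes every toppled vertex new, as the disjointness in
    [topple_config] demands. *)
Lemma topple_seq_config n d (c : config n d) us : uniq (None :: us) ->
  (forall i, (i < size us)%N ->
     unstable (topple_seq (None :: take i us) c) (nth None us i)) ->
  forall i, (i <= size us)%N ->
    topple_seq (None :: take i us) c = toppled_config c [set v in None :: take i us] /\
    legal c [set v in None :: take i us].
Proof.
move=> Uus uns; elim=> [_|i IH lti].
  rewrite take0; have -> : [set v in [:: None]] = [set None] :> {set vertex n d}.
    by apply/setP => v; rewrite !inE.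
  exact: topple_sink.
have [topE leg] := IH (ltnW lti).
have -> : [set v in None :: take i.+1 us] =
    [set v in None :: take i us] :|: [set nth None us i].
  by apply/setP => v; rewrite (take_nth None lti) !inE mem_rcons inE orbA orbAC -orbA.
have -> : topple_seq (None :: take i.+1 us) c =
    topple [set nth None us i] (toppled_config c [set v in None :: take i us]).
  by rewrite -topE (take_nth None lti) -rcons_cons /topple_seq -cats1 foldl_cat.
apply: topple_config => // [|x]; last first.
  by rewrite inE => /eqP->; rewrite -topE; apply: uns.
rewrite disjoint_sym disjoints1 inE.
have: uniq (None :: take i.+1 us).
  by move: Uus; rewrite -{1}(cat_take_drop i.+1 us) -cat_cons cat_uniq => /andP[].
by rewrite (take_nth None lti) -rcons_cons rcons_uniq => /andP[].
Qed.

Lemma abscissa_gt n d (c : config n d) k : (d < k)%N -> abscissa c k = n.+1.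
Proof. by case: k => //= k ltdk; rewrite insubN // -leqNgt. Qed.

Lemma levels_gt n d (c : config n d) k : (n < k)%N -> levels c k = (n + d).+1.
Proof. by case: k => //= k ltnk; rewrite insubN // -leqNgt. Qed.

(** [rev_ord] reverses the decreasing order of the configuration, and stability keeps the entries
    below the padding. *)
Lemma homo_abscissa n d (c : config n d) : sorted_rec c ->
  {homo abscissa c : i j / (i <= j)%N}.
Proof.
move=> [[st _] _ sortb] [|i] [|j] // leij; have [ltj|gej] := ltnP j d; last first.
  rewrite (@abscissa_gt _ _ _ j.+1) //=.
  by case: insubP => [k _ _|_] //; rewrite ltnS stable_indep_bound.
have lti : (i < d)%N by lia.
rewrite /= (insubT (fun k => k < d)%N ltj) (insubT (fun k => k < d)%N lti) /=.
by rewrite ltnS; apply: sortb => /=; lia.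
Qed.

Lemma homo_levels n d (c : config n d) : sorted_rec c ->
  {homo levels c : i j / (i <= j)%N}.
Proof.
move=> [[st _] sorta _] [|i] [|j] // leij; have [ltj|gej] := ltnP j n; last first.
  rewrite (@levels_gt _ _ _ j.+1) //=.
  by case: insubP => [k _ _|_] //; rewrite ltnS stable_clique_bound.
have lti : (i < n)%N by lia.
rewrite /= (insubT (fun k => k < n)%N ltj) (insubT (fun k => k < n)%N lti) /=.
by rewrite !ltnS; apply: sorta => /=; lia.
Qed.

(* If the inequality fails at [(x, y)], no vertex outside [done_set n d x y] can
   ever be the first one to topple. *)
Lemma sorted_rec_gap n d (c : config n d) x y : sorted_rec c ->
  (x <= n)%N -> (y <= d)%N -> (0 < x + y)%N ->
  (0 < x)%N && (x + y < levels c x)%N || (0 < y)%N && (x < abscissa c y)%N.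
Proof.
move=> sc lexn leyd xy0; apply: contraT; rewrite negb_or !negb_and -!leqNgt => /andP[stuckx stucky].
have homoX := homo_abscissa sc; have homoY := homo_levels sc.
have [[st [us [us_perm uns]]] _ _] := sc.
have Uus : uniq (None :: us) by rewrite (perm_uniq us_perm) enum_uniq.
have in_done i : (i < size us)%N -> nth None us i \in done_set n d x y.
  elim/ltn_ind: i => i IH lti.
  have [topE _] := topple_seq_config Uus uns (ltnW lti).
  have sub : [set v in None :: take i us] \subset done_set n d x y.
    apply/subsetP => v; rewrite in_set in_cons => /predU1P[->|]; first by rewrite inE.
    case/(nthP None) => j; rewrite size_take lti => ltji <-.
    by rewrite nth_take // IH //; lia.
  have := uns i lti; rewrite topE; case uE : (nth None us i) => [v|//] /= unsv.
  apply: contraT => vS; have vT : Some v \notin [set v in None :: take i us].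
    by apply: contraNN vS; apply: (subsetP sub).
  move: unsv; rewrite ffunE (negbTE vT) subn0.
  (* Only vertices of [done_set n d x y] have toppled, and by monotonicity the entry of [v] in
     [levels] or [abscissa] is at most the one at [x] or [y], too small for [v] to be unstable. *)
  have := toppled_nbrs_sub v sub; case: v vS {vT uE} => [k|k]; rewrite inE -leqNgt => ltk.
    rewrite [X in (_ <= X)%N -> _]toppled_nbrs_clique ?card_done_set // ?inE -?leqNgt //.
    rewrite deg_clique; have := homoY _ _ ltk; rewrite levelsE.
    move: (c _) (toppled_nbrs _ _) => a h; have := ltn_ord k; lia.
  rewrite [X in (_ <= X)%N -> _]toppled_nbrs_indep // deg_indep.
  have := homoX _ _ ltk; rewrite abscissaE.
  move: (c _) (toppled_nbrs _ _) => a h; have := ltn_ord k; lia.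
have all_done v : v \in done_set n d x y.
  have : v \in None :: us by rewrite (perm_mem us_perm) mem_enum.
  rewrite in_cons => /predU1P[->|]; first by rewrite inE.
  by case/(nthP None) => i lti <-; apply: in_done.
(* The vertex of index [n - x] or [d - y] is outside the set, although the ordering lists all
   vertices. *)
have [x0|xgt] := posnP x; last first.
  have ltx : (n - x < n)%N by lia.
  by have := all_done (Some (inl (Ordinal ltx))); rewrite inE /=; lia.
have lty : (d - y < d)%N by lia.
by have := all_done (Some (inr (Ordinal lty))); rewrite inE /=; lia.
Qed.

Lemma sorted_rec_data n d (c : config n d) : sorted_rec c ->
  sawtooth_data n d (abscissa c) (levels c).
Proof.
move=> sc; split=> //.
- exact: abscissa_gt.
- exact: homo_abscissa.
- exact: levels_gt.
- exact: homo_levels.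
by move=> x y; apply: sorted_rec_gap.
Qed.

Lemma f_ndE n d (c : config n d) : sorted_rec c ->
  f_nd c = (upp_path n.+1 (levels c), low_path d (abscissa c)).
Proof.
move=> sc; have sd := sorted_rec_data sc; congr (_, _); last first.
  rewrite /f_low /low_path (sd_Xd sd) //; congr join.
  rewrite /low_segments -val_enum_ord -map_comp; apply: eq_map => k /=.
  rewrite valK; congr (_, _); apply: point_eq; lia.
rewrite /f_upp /upp_path (sd_Yn sd) //.
have -> : ((n.+1)%:Z, d%:Z) = ((n.+1)%:Z, ((n + d).+1)%:Z - (n.+1)%:Z) :> Defs.point.
  by apply: point_eq; lia.
(* The last index [n] of the iota has the padding level and yields the fixed diagonal from
   [(n, d + 1)] to [(n + 1, d)]. *)
congr join; rewrite /upp_segments -[n.+1]addn1 iotaD map_cat /=; congr cat.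
  rewrite -val_enum_ord -map_comp; apply: eq_map => k /=.
  rewrite valK; congr (_, _); apply: point_eq; lia.
rewrite add0n insubN ?ltnn //; congr [:: (_, _)]; apply: point_eq; lia.
Qed.

(** * CTI rounds and the bounce path *)

(** For [F] the sequence Y or X, [k'] is both the number of clique or independent vertices left
    after half a round and the coordinate at which the bounce path turns. *)
Lemma last_below (F : nat -> nat) (b k : nat) : F 0%N = 0%N ->
  exists2 k', (k' <= k)%N && (F k' <= b)%N & forall j, (k' < j <= k)%N -> (b < F j)%N.
Proof.
move=> F0; have ex : exists j, (j <= k)%N && (F j <= b)%N by exists 0%N; rewrite F0.
have bd j : (j <= k)%N && (F j <= b)%N -> (j <= k)%N by case/andP.
case: (ex_maxnP ex bd) => k' k'P max_k'; exists k' => // j /andP[ltj lej].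
rewrite ltnNge; apply/negP => leF; have := max_k' j; rewrite lej leF => /(_ isT).
by rewrite leqNgt ltj.
Qed.

Section Rounds.
Variables (n d : nat) (c : config n d).
Hypothesis sc : sorted_rec c.

Let X := abscissa c.
Let Y := levels c.
Let done := @done_set n d.
Let sd := sorted_rec_data sc.
Let st : stable c. Proof. by have [[]] := sc. Qed.

(** Away from [(0, 0)], [sd_gap] designates an unstable vertex: the first in index order of the
    remaining clique or independent ones. At [(0, 0)] all have toppled. *)
Lemma stable_config_done x y : (x <= n)%N -> (y <= d)%N ->
  stable (toppled_config c (done x y)) = (x + y == 0)%N.
Proof.
move=> lexn leyd; apply/forallP/eqP => [stxy|xy0 v].
  apply/eqP; rewrite -leqn0 leqNgt; apply/negP => xy0.
  have := sd_gap sd lexn leyd xy0; case/orP => /andP[gt0 lt].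
    have ltx : (n - x < n)%N by lia.
    have := stxy (Some (inl (Ordinal ltx))).
    rewrite unstable_clique_done //=; have -> : (n - (n - x) = x)%N by lia.
    by rewrite lt leqnn.
  have lty : (d - y < d)%N by lia.
  have := stxy (Some (inr (Ordinal lty))).
  rewrite unstable_indep_done //=; have -> : (d - (d - y) = y)%N by lia.
  by rewrite lt leqnn.
have [-> ->] : x = 0%N /\ y = 0%N by lia.
case: v => [v|] //; apply: unstable_toppled => //.
by case: v => k; rewrite inE subn_gt0.
Qed.

Lemma card_done_setD x y x' y' : (x' <= x <= n)%N -> (y' <= y <= d)%N ->
  #|done x' y' :\: done x y| = ((x - x') + (y - y'))%N.
Proof.
move=> bdx bdy; rewrite cardsD.
have -> : done x' y' :&: done x y = done x y.
  by apply/setIidPr/subsetP => -[[k|k]|]; rewrite !inE //; lia.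
by rewrite !card_done_set; lia.
Qed.

(** Since [Y] is monotone, the unstable clique vertices are those whose rank [n - k] lies strictly
    above [x'] and at most at [x]. *)
Lemma CTI_P_done x y x' : (x' <= x <= n)%N -> (y <= d)%N ->
  (Y x' <= x + y)%N -> (forall j, (x' < j <= x)%N -> (x + y < Y j)%N) ->
  CTI_P (toppled_config c (done x y)) = done x' y :\: done x y.
Proof.
move=> bdx bdy Yx' maxx'; apply/setP => -[[k|k]|]; rewrite inE in_setD andbC.
- rewrite andTb unstable_clique_done //; last by lia.
  rewrite !inE -leqNgt; case: (leqP (n - k) x) => //= lek; rewrite ?andbT.
  have [ltx'|gex'] := ltnP x' (n - k).
    by apply: maxx'; rewrite ltx'.
  by apply/negbTE; rewrite -leqNgt; apply: leq_trans Yx'; apply: (sd_Y sd).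
- by rewrite andFb !inE andNb.
by rewrite andFb !inE.
Qed.

Lemma CTI_Q_done x y y' : (x <= n)%N -> (y' <= y <= d)%N ->
  (X y' <= x)%N -> (forall j, (y' < j <= y)%N -> (x < X j)%N) ->
  unstable_indep (toppled_config c (done x y)) = done x y' :\: done x y.
Proof.
move=> bdx bdy Xy' maxy'; apply/setP => -[[k|k]|]; rewrite inE in_setD andbC.
- by rewrite andFb !inE andNb.
- rewrite andTb unstable_indep_done //.
  rewrite !inE -leqNgt; case: (leqP (d - k) y) => //= lek; rewrite ?andbT.
  have [lty'|gey'] := ltnP y' (d - k).
    by apply: maxy'; rewrite lty'.
  by apply/negbTE; rewrite -leqNgt; apply: leq_trans Xy'; apply: (sd_X sd).
by rewrite andFb !inE.
Qed.

(** Induction on [x + y]: one CTI round and one bounce both lead from [(x, y)] to the same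
    [(x', y')]. The bounds at [x.+1] and [y.+1] place the start of the bounce relative to the two
    paths; maximality of [x'] and [y'] restores them. *)
Lemma rounds_bounce x y : (0 < x + y)%N -> (x <= n)%N -> (y <= d)%N ->
  (x + y < Y x.+1)%N -> (x < X y.+1)%N -> legal c (done x y) ->
  exists w, CTI_rounds (toppled_config c (done x y)) w /\
    bounce_from (upp_path n.+1 Y, low_path d X) (x%:Z, y%:Z) w.
Proof.
have [m] := ubnP (x + y); elim: m x y => // m IH x y ltm xy0 lexn leyd Yx Xy leg.
have [x' /andP[lex' Yx'] maxx'] := @last_below Y (x + y) x (sd_Y0 sd).
have [y' /andP[ley' Xy'] maxy'] := @last_below X x' y (sd_X0 sd).
have bdx : (x' <= x <= n)%N by lia.
have bdy : (y' <= y <= d)%N by lia.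
have Pxy := CTI_P_done bdx leyd Yx' maxx'.
have Qxy : unstable_indep (toppled_config c (done x' y)) = done x' y' :\: done x' y.
  by apply: CTI_Q_done => //; lia.
have toppleD a b a' b' (A : {set vertex n d}) : legal c (done a b) -> (a' <= a)%N -> (b' <= b)%N ->
    (forall v, v \in A -> unstable (toppled_config c (done a b)) v) ->
    A = done a' b' :\: done a b ->
    topple A (toppled_config c (done a b)) = toppled_config c (done a' b') /\ legal c (done a' b').
  move=> legab lea leb unsA AE.
  have -> : done a' b' = done a b :|: A.
    by rewrite AE; apply/setP => -[[k|k]|]; rewrite !inE //; lia.
  apply: topple_config => // [|v /unsA //].
  by rewrite disjoint_sym disjoints_subset AE setDE subsetIr.
have [topP legP] : topple (CTI_P (toppled_config c (done x y))) (toppled_config c (done x y)) =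
    toppled_config c (done x' y) /\ legal c (done x' y).
  by apply: toppleD Pxy => // v; rewrite inE => /andP[].
have [topQ legQ] :
    topple (unstable_indep (toppled_config c (done x' y))) (toppled_config c (done x' y)) =
    toppled_config c (done x' y') /\ legal c (done x' y').
  by apply: toppleD Qxy => // v; rewrite inE => /andP[].
have QE : CTI_Q (toppled_config c (done x y)) = done x' y' :\: done x' y.
  by rewrite /CTI_Q topP.
have roundE : CTI_round (toppled_config c (done x y)) = toppled_config c (done x' y').
  by rewrite /CTI_round topP QE -Qxy.
have cardP : #|CTI_P (toppled_config c (done x y))| = (x - x')%N.
  by rewrite Pxy card_done_setD; lia.
have cardQ : #|CTI_Q (toppled_config c (done x y))| = (y - y')%N.
  by rewrite QE card_done_setD; lia.
have meetP := sd_meets_nw sd bdx Yx Yx' maxx'.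
have zE : (x%:Z, y%:Z) + step_nw *+ (x - x') = (x'%:Z, (y + (x - x'))%:Z) :> point.
  by rewrite mul_step_nw; apply: point_eq => /=; lia.
have meetQ := sd_meets_s sd (x - x') bdx bdy Xy Xy' maxy'.
have z'E : (x'%:Z, (y + (x - x'))%:Z) + step_s *+ (x - x' + (y - y')) =
    (x'%:Z, y'%:Z) :> point.
  by rewrite mul_step_s; apply: point_eq => /=; lia.
have stE := @stable_config_done x' y'.
have [xy'0|xy'gt] := posnP (x' + y').
  exists [:: (x - x')%N; (y - y')%N]; split.
    by rewrite -cardP -cardQ; apply: CTI_stop; rewrite roundE stE ?xy'0 //; lia.
  by apply: bounce_stop => //; rewrite zE // z'E; apply: point_eq; lia.
have [|||||w [Rw Bw]] := IH x' y' _ xy'gt _ _ _ _ legQ.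
(* Progress: the first alternative of [sd_gap] excludes [x' = x], the second [y' = y]. *)
- have := sd_gap sd lexn leyd xy0; case/orP => /andP[gt0 lt].
    by have [x'x|ne] := eqVneq x' x; [move: Yx'; rewrite x'x leqNgt lt|lia].
  have [y'y|ne] := eqVneq y' y; last by lia.
  by move: Xy'; rewrite y'y leqNgt (leq_ltn_trans lex' lt).
- lia.
- lia.
- have [x'x|ne] := eqVneq x' x; first by rewrite x'x; lia.
  by have := maxx' x'.+1; lia.
- have [y'y|ne] := eqVneq y' y; first by rewrite y'y; lia.
  by have := maxy' y'.+1; lia.
exists [:: (x - x')%N, (y - y')%N & w]; split.
  rewrite -cardP -cardQ; apply: CTI_next; rewrite roundE // stE; lia.
apply: bounce_next; rewrite ?zE ?z'E //.
by case=> x'0 y'0; lia.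
Qed.
End Rounds.

(** * Height, area and the final assembly *)

Lemma bin2D m k : 'C(m + k, 2) = ('C(m, 2) + 'C(k, 2) + m * k)%N.
Proof.
elim: m => [|m IH]; first by rewrite bin0n !add0n addn0.
by rewrite addSn !binS !bin1 IH; lia.
Qed.

(** The column sums give the clique grains up to a triangular number, the last column adding [d];
    the row sums give the independent grains. [bin2D] absorbs the remaining constants. *)
Lemma height_area n d X Y (c : config n d) A : sawtooth_data n d X Y ->
  (forall i : 'I_n, Y (n - i)%N = (c (inl i)).+2) ->
  (forall j : 'I_d, X (d - j)%N = (c (inr j)).+1) ->
  (A + \sum_(0 <= y < d) (n.+1 - X y.+1) = \sum_(0 <= x < n.+1) (Y x.+1 - x.+1))%N ->
  (height c + (n + d) + 'C(d, 2) = A + 'C(n + d, 2))%N.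
Proof.
move=> sd Yc Xc; rewrite big_nat_recr //= (sd_Yn sd) // bin2D /height.
have YS : (\sum_(0 <= x < n) (Y x.+1 - x.+1) + ('C(n, 2) + n) =
    \sum_(i < n) c (inl i) + (n + n))%N.
  have -> : ('C(n, 2) + n = \sum_(0 <= x < n) x.+1)%N.
    elim: (n) => [|m IH]; first by rewrite big_geq.
    by rewrite big_nat_recr //= -IH binS bin1; lia.
  rewrite -big_split /= big_mkord (reindex_inj rev_ord_inj) /=.
  have -> : (n + n = \sum_(i < n) 2)%N by rewrite sum_nat_const card_ord; lia.
  rewrite -big_split /=; apply: eq_bigr => i _.
  have -> : (n - i.+1).+1 = (n - i)%N by have := ltn_ord i; lia.
  (* [sd_gap] at [(n - i, 0)] makes the truncated subtraction exact. *)
  rewrite subnK ?Yc ?addn2 //; have := @sd_gap _ _ _ _ sd (n - i)%N 0.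
  by rewrite Yc; move: (c _) (ltn_ord i) => a; lia.
have XS : (\sum_(0 <= y < d) (n.+1 - X y.+1) + (\sum_(j < d) c (inr j) + d) = d * n.+1)%N.
  have -> : (d * n.+1 = \sum_(j < d) n.+1)%N by rewrite sum_nat_const card_ord; lia.
  have -> : (\sum_(j < d) c (inr j) + d = \sum_(j < d) (c (inr j)).+1)%N.
    rewrite -[X in (_ + X)%N]card_ord -sum1_card -big_split /=.
    by apply: eq_bigr => j _; rewrite addn1.
  rewrite big_mkord (reindex_inj rev_ord_inj) /= -big_split /=; apply: eq_bigr => j _.
  have -> : (d - j.+1).+1 = (d - j)%N by have := ltn_ord j; lia.
  rewrite -Xc subnK // -(sd_Xd sd (ltnSn d)); apply: (sd_X sd); lia.
move: (\sum_(0 <= x < n) _)%N (\sum_(0 <= y < d) _)%N YS XS => a b.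
move: (\sum_(i < n) _)%N (\sum_(j < d) _)%N => e f; lia.
Qed.

Theorem theorem4p11 (R : realType) (n d : nat) (hn : (1 <= n)%N) (hd : (1 <= d)%N)
    (c : config n d) (hc : sorted_rec c) :
  let P := f_nd c in
  [/\ sawtooth n.+1 d P,
      (height c)%:Z =
        (area R P)%:Z - (n + d)%:Z + ('C(n + d, 2))%:Z - ('C(d, 2))%:Z &
      exists w : seq nat, topple_CTI c w /\ ctiBounce n d P w].
Proof.
have sd := sorted_rec_data hc; rewrite /= f_ndE //; split.
- exact: sd_sawtooth.
- have := height_area sd (levelsE c) (abscissaE c) (sd_area R sd); lia.
(* Once the sink has toppled, all [n] clique and [d] independent vertices are left: the rounds start
   at [(n, d)], as the bounce path does. *)
have doneE : done_set n d n d = [set None].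
  by apply/setP => -[[k|k]|]; rewrite !inE //= ?(ltnNge n) ?(ltnNge d) leq_subr.
have [topE leg] := topple_sink c.
rewrite /topple_CTI /ctiBounce topE -doneE; apply: rounds_bounce => //.
- by lia.
- by rewrite (sd_Yn sd).
- by rewrite (sd_Xd sd).
by rewrite doneE.
Qed.
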